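(* Let $k\geq 2$, let $p=z^k-w^k$, let $n\ge 0$, and write $n=kq+r$ with integers $q\ge0$ and $0\leq r<k$. Let $A^n$ be the $(n+1)\times(n+1)$ Toeplitz matrix associated with $p$, and let $A^n_{n,l}$ be the cofactor of its entry in row $n$ and column $l$. Then for $0\leq l\leq n$, $$A^n_{n,l}=\begin{cases}\dfrac{(n-r+2k)^r\,(n-r+k)^{k-r-1}\,(k+l-r)}{k^k}, & l\equiv r \pmod k,\\[3mm] 0, & \text{otherwise}.\end{cases}$$
   Context: The inner product is that of the Hardy space $H^2(\mathbb D^2)$ of the bidisk with coordinates $(z,w)$, in which the monomials $z^aw^b$ ($a,b\ge0$) are orthonormal. For a homogeneous polynomial $p$ and $n\ge0$, the associated matrix $A^n$ is the $(n+1)\times(n+1)$ Toeplitz matrix $(a_{i,l})_{i,l=0}^n$ with $a_{i,l}=\langle p z^{l}w^{n-l},\,p z^{i}w^{n-i}\rangle$, i.e. $a_{i,l}=\langle pw^{i-l},pz^{i-l}\rangle$ for $i\ge l$ and $a_{i,l}=\overline{a_{l,i}}$ for $i<l$. Rows and columns are indexed from $0$ to $n$. The cofactor is the signed (algebraic) cofactor, i.e. $(-1)^{i+l}$ times the corresponding minor, with $A^0_{0,0}=1$. *)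

(* Defs.v *)
From HB Require Import structures.
From mathcomp Require Import all_boot all_order all_algebra.
From mathcomp Require Import reals.
From mathcomp Require Import complex mpoly.

Set Implicit Arguments.
Unset Strict Implicit.
Unset Printing Implicit Defensive.

Import Order.TTheory GRing.Theory Num.Theory.
Local Open Scope ring_scope.
Local Open Scope complex_scope.

Section Bidisk.
Variable R : realType.
Local Notation C := R[i].

Definition varz : {mpoly C[2]} := 'X_ord0.
Definition varw : {mpoly C[2]} := 'X_ord_max.

(* The inner product of H^2(D^2) restricted to polynomials: the sesquilinear
   form, linear in the first argument, for which monomials are orthonormal. *)
Definition hardy_inner (f g : {mpoly C[2]}) : C :=
  \sum_(m <- msupp f) f@_m * Num.conj g@_m.

Definition assoc_mx (p : {mpoly C[2]}) (n : nat) : 'M[C]_n.+1 :=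
  \matrix_(i, l) hardy_inner (p * varz ^+ l * varw ^+ (n - l))
                             (p * varz ^+ i * varw ^+ (n - i)).

End Bidisk.

Arguments varz {R}.
Arguments varw {R}.

(* Main.v *)
(* Ordering the basis by residues mod k makes A^n a direct sum of tridiagonal
   (-1, 2, -1) Toeplitz matrices, and the vector supported on l = n mod k with
   value l %/ k + 1 is mapped by A^n to (q + 2) e_n.  Applying the adjugate, this
   gives the last row of cofactors up to the factor \det A^n / (q + 2).  The entry
   l = n of that row is \det A^(n-1), which yields a recurrence for \det A^n. *)
Require Import Defs.
From mathcomp Require Import all_boot all_order all_algebra.
From mathcomp Require Import reals.
From mathcomp Require Import complex mpoly.
From mathcomp Require Import zify ring.

Import Order.TTheory GRing.Theory Num.Theory.
Local Open Scope ring_scope.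
Local Open Scope complex_scope.

(** Indices are compared through [l + k] and [i + k], so that no truncated subtraction enters. *)
Definition second_diff_mx (F : pzRingType) (k n : nat) : 'M[F]_n :=
  \matrix_(i, l) ((i == l :> nat)%:R *+ 2 - (i == l + k :> nat)%N%:R
                  - (l == i + k :> nat)%N%:R).

Definition residue_ramp (F : pzRingType) (k n l : nat) : F :=
  if l == n %[mod k] then (l %/ k).+1%:R else 0.

Lemma sum_ord_delta (F : pzRingType) (n m : nat) (y : nat -> F) :
  \sum_(l < n) (m == l)%:R * y l = if (m < n)%N then y m else 0.
Proof.
case: ltnP => mn.
  rewrite (bigD1 (Ordinal mn)) //= eqxx mul1r big1 ?addr0 // => l /eqP neq.
  case: eqP => [E|_]; last by rewrite mul0r.
  by case: neq; apply: val_inj.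
rewrite big1 // => l _; case: eqP => [E|_]; last by rewrite mul0r.
by have := ltn_ord l; rewrite -E ltnNge mn.
Qed.

(** On the class of [n] the ramp is linear in steps of [k], so its second differences vanish. Only
    row [n] lacks its upper neighbour, whose value would be [(n %/ k).+2]. *)
Lemma second_diff_residue_ramp (F : comNzRingType) (k n : nat) (i : 'I_n.+1) :
  (0 < k)%N ->
  \sum_(l < n.+1) second_diff_mx F k n.+1 i l * residue_ramp F k n l
  = (n %/ k).+2%:R *+ (i == ord_max).
Proof.
move=> k0; set y := residue_ramp F k n.
have yD m : y (m + k)%N = if m == n %[mod k] then (m %/ k).+2%:R else 0.
  by rewrite /y /residue_ramp modnDr divnDr ?dvdnn // divnn k0 addn1.
have shiftl : \sum_(l < n.+1) ((i : nat) == l + k)%N%:R * y l =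
    if (k <= i)%N then y (i - k)%N else 0.
  case: leqP => ki; last first.
    rewrite big1 // => l _; case: eqP => [E|_]; last by rewrite mul0r.
    by move: ki; rewrite E ltnNge leq_addl.
  rewrite -[RHS](_ : (if (i - k < n.+1)%N then y (i - k)%N else 0) = _).
    rewrite -sum_ord_delta; apply: eq_bigr => l _.
    by congr (_%:R * _); congr nat_of_bool; lia.
  by rewrite ifT //; have := ltn_ord i; lia.
have shiftr : \sum_(l < n.+1) ((l : nat) == i + k)%N%:R * y l =
    if (i + k < n.+1)%N then y (i + k)%N else 0.
  by rewrite -sum_ord_delta; apply: eq_bigr => l _; rewrite eq_sym.
have diag : \sum_(l < n.+1) ((i : nat) == l)%:R * y l = y i.
  by rewrite sum_ord_delta ltn_ord.
under eq_bigr => l _ do rewrite mxE !mulrBl mulr2n mulrDl.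
rewrite !sumrB big_split /= diag shiftl shiftr {shiftl shiftr diag}.
have -> : (i == ord_max) = (i == n :> nat) by [].
have ile : (i <= n)%N by rewrite -ltnS.
move: (nat_of_ord i) ile => {}i ile.
have [E|neq] := boolP (i == n %[mod k]); last first.
  have yi0 : y i = 0 by rewrite /y /residue_ramp (negbTE neq).
  rewrite yi0 yD (negbTE neq) if_same addr0 subr0 sub0r.
  have -> : (i == n) = false by apply: contraNF neq => /eqP ->.
  case: leqP => ki; rewrite ?oppr0 ?subr0 ?oppr0 //.
  by rewrite /y /residue_ramp -(modnDr (i - k)) subnK // (negbTE neq) oppr0.
(* The ramp extends by 0 below the first index of the class, so one formula also covers [i < k]. *)
have lower : (if (k <= i)%N then y (i - k)%N else 0) = (i %/ k)%:R.
  case: leqP => ki; last by rewrite divn_small.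
  rewrite -{2}(subnK ki) divnDr ?dvdnn // divnn k0 addn1 /y /residue_ramp.
  by rewrite -(modnDr (i - k)) subnK // E.
rewrite lower yD /y /residue_ramp E.
(* For [i <= n] in the same class, the quotients decide: a smaller one leaves room for a full step
   [k]. *)
have -> : (i + k < n.+1)%N = (i != n).
  move/eqP: E => E; have := divn_eq n k; have := divn_eq i k; rewrite E.
  set a := (i %/ k)%N; set b := (n %/ k)%N => Ei En.
  have [ab|ab|ab] := ltngtP a b.
  - have := leq_mul ab (leqnn k); rewrite mulSn.
    by case: eqP; lia.
  - have := leq_mul ab (leqnn k); rewrite mulSn; lia.
  - by case: eqP; rewrite ab in Ei; lia.
case: eqP => [->|_] /=; rewrite ?mulr1n ?mulr0n -!natr1; ring.
Qed.

(** [\adj A] sends [A *m v] to [\det A *: v], and its last column is the last row of cofactors. *)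
Lemma cofactor_second_diff_mx (F : comNzRingType) (k n : nat) (l : 'I_n.+1) :
  (0 < k)%N ->
  cofactor (second_diff_mx F k n.+1) ord_max l * (n %/ k).+2%:R =
  \det (second_diff_mx F k n.+1) * residue_ramp F k n l.
Proof.
move=> k0; set A := second_diff_mx F k n.+1.
pose v : 'cV[F]_n.+1 := \col_i residue_ramp F k n i.
have Av : A *m v = \col_i ((n %/ k).+2%:R *+ (i == ord_max)).
  apply/matrixP => i j; rewrite !mxE -second_diff_residue_ramp //.
  by apply: eq_bigr => m _; rewrite [v _ _]mxE.
have := congr1 (fun M : 'cV_n.+1 => M l 0) (mulmxA (\adj A) A v).
rewrite mul_adj_mx mul_scalar_mx Av !mxE => <-.
rewrite (bigD1 ord_max) //= big1 => [|m /negbTE neq]; rewrite !mxE ?neq ?mulr0 //.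
by rewrite eqxx mulr1n addr0.
Qed.

Lemma cofactor_max_second_diff_mx (F : comNzRingType) (k n : nat) :
  cofactor (second_diff_mx F k n.+1) ord_max ord_max =
  \det (second_diff_mx F k n).
Proof.
rewrite /cofactor addnn -signr_odd odd_double expr0 mul1r; congr (\det _).
by apply/matrixP => i j; rewrite !mxE !lift_max.
Qed.

(** A tridiagonal block of size m has determinant m + 1; [n %% k] classes have [n %/ k + 1] elements
    and the others [n %/ k]. The induction instead uses the recurrence given by the corner
    cofactor. *)
Lemma det_second_diff_mx (F : numFieldType) (k n : nat) :
  (0 < k)%N ->
  \det (second_diff_mx F k n) =
  (n %/ k).+2%:R ^+ (n %% k) * (n %/ k).+1%:R ^+ (k - n %% k).
Proof.
move=> k0; elim: n => [|n IHn].
  by rewrite det_mx00 div0n mod0n expr0 mul1r expr1n.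
have q0 : (n %/ k).+1%:R != 0 :> F by rewrite pnatr_eq0.
apply: (mulIf q0).
have := cofactor_second_diff_mx F k n ord_max k0.
rewrite cofactor_max_second_diff_mx /residue_ramp eqxx => <-.
rewrite IHn {IHn}.
have rk := ltn_pmod n k0.
have En : n.+1 = (n %/ k * k + (n %% k).+1)%N by rewrite addnS -divn_eq.
have [rk1|rk1] := ltnP (n %% k).+1 k.
  have -> : (n.+1 %/ k = n %/ k)%N.
    by rewrite [in LHS]En divnMDl // (divn_small rk1) addn0.
  have -> : (n.+1 %% k = (n %% k).+1)%N by rewrite [in LHS]En modnMDl (modn_small rk1).
  have -> : (k - n %% k = (k - (n %% k).+1).+1)%N by lia.
  by rewrite !exprS; ring.
(* Here [k] divides [n.+1]: the quotient rises and the remainder returns to 0. *)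
have rE : (n %% k).+1 = k by lia.
have -> : (n.+1 %/ k = (n %/ k).+1)%N by rewrite [in LHS]En rE divnMDl // divnn k0 addn1.
have -> : (n.+1 %% k = 0)%N by rewrite [in LHS]En rE modnMDl modnn.
have -> : (k - n %% k = 1)%N by lia.
have rX (x : F) : x ^+ k = x ^+ (n %% k) * x by rewrite -exprSr rE.
by rewrite subn0 expr0 mul1r rX; ring.
Qed.

Lemma hardy_inner_sub_monomials (R : realType) (a b : 'X_{1..2})
    (g : {mpoly R[i][2]}) :
  a != b -> hardy_inner ('X_[a] - 'X_[b]) g = Num.conj g@_a - Num.conj g@_b.
Proof.
move=> ab; rewrite /hardy_inner.
(* Since [a != b] nothing cancels, and the support is {a, b} in an unknown order. *)
rewrite (perm_big [:: a; b]) /=; last first.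
  apply: uniq_perm; rewrite ?msupp_uniq //= ?inE ?ab // => m.
  rewrite mcoeff_msupp mcoeffB !mcoeffX !inE ![m == _]eq_sym.
  case: (eqVneq a m) => [<-|_]; first by rewrite [b == a]eq_sym (negbTE ab) subr0 oner_eq0.
  by case: (b == m); rewrite ?sub0r ?subr0 ?oppr_eq0 ?oner_eq0 ?eqxx.
rewrite !big_cons big_nil !mcoeffB !mcoeffX !eqxx [b == a]eq_sym (negbTE ab).
by rewrite subr0 sub0r mul1r mulN1r addr0.
Qed.

Definition bimonom (a b : nat) : 'X_{1..2} :=
  (U_(ord0) *+ a + U_(ord_max) *+ b)%MM.

Lemma bimonom_eq (a b c d : nat) :
  (bimonom a b == bimonom c d) = (a == c) && (b == d).
Proof.
apply/eqP/andP => [E|[/eqP-> /eqP->] //].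
have := congr1 (fun m : 'X_{1..2} => m ord0) E.
have := congr1 (fun m : 'X_{1..2} => m ord_max) E.
by rewrite !mnmDE !mulmnE !mnm1E /= !mul0n !mul1n !addn0 !add0n => -> ->.
Qed.

Lemma mul_varz_varw (R : realType) (k a b : nat) :
  (varz ^+ k - varw ^+ k : {mpoly R[i][2]}) * varz ^+ a * varw ^+ b =
  'X_[bimonom (a + k) b] - 'X_[bimonom a (b + k)].
Proof. by rewrite /bimonom !mpolyXD -!mpolyXn -/varz -/varw !exprD; ring. Qed.

Lemma assoc_mx_sub_exp (R : realType) (k n : nat) : (0 < k)%N ->
  assoc_mx (varz ^+ k - varw ^+ k : {mpoly R[i][2]}) n =
  second_diff_mx R[i] k n.+1.
Proof.
move=> k0; apply/matrixP => i l; rewrite !mxE !mul_varz_varw.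
have ilt := ltn_ord i; have llt := ltn_ord l.
have neq m : (m + k == m)%N = false by apply/eqP; lia.
rewrite hardy_inner_sub_monomials ?bimonom_eq ?neq //.
rewrite !mcoeffB !mcoeffX !bimonom_eq -!rmorphB /=.
(* Of the four monomial pairings, the two of equal sign give the 2 on the diagonal and the mixed
   ones the -1 entries. As [i] and [l] are at most [n], the exponents of z determine those of w. *)
have -> : ((i + k == l + k) && (n - i == n - l))%N = (i == l :> nat) by lia.
have -> : ((i : nat) == l + k)%N && (n - i + k == n - l)%N = (i == l + k :> nat)%N.
  by lia.
have -> : ((i + k)%N == l) && (n - i == n - l + k)%N = (l == i + k :> nat)%N by lia.
have -> : ((i : nat) == l) && (n - i + k == n - l + k)%N = (i == l :> nat) by lia.
rewrite !rmorphB !rmorph_nat; ring.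
Qed.

Theorem theorem3p2 (R : realType) (k n q r : nat) (hk : (2 <= k)%N)
    (hn : n = (k * q + r)%N) (hr : (r < k)%N) (l : 'I_n.+1) :
  cofactor (assoc_mx (varz ^+ k - varw ^+ k : {mpoly R[i][2]}) n) ord_max l =
  if l == r %[mod k] then
    (n%:R - r%:R + 2 * k%:R) ^+ r * (n%:R - r%:R + k%:R) ^+ (k - r - 1)
      * (k%:R + l%:R - r%:R) / k%:R ^+ k
  else 0 :> R[i].
Proof.
have k0 : (0 < k)%N by apply: leq_trans hk.
have nk : (n %/ k = q)%N by rewrite hn mulnC divnMDl // divn_small ?addn0.
have nr : (n %% k = r)%N by rewrite hn mulnC modnMDl modn_small.
rewrite assoc_mx_sub_exp //; set A := second_diff_mx _ _ _.
have q1 : q.+1%:R != 0 :> R[i] by rewrite pnatr_eq0.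
have q2 : q.+2%:R != 0 :> R[i] by rewrite pnatr_eq0.
(* The recurrence from size [n] avoids a case split on [r.+1 = k], which the closed form at [n.+1]
   would need. *)
have detA : \det A = q.+2%:R ^+ r * q.+1%:R ^+ (k - r - 1) * q.+2%:R.
  apply: (mulIf q1).
  have := cofactor_second_diff_mx R[i] k n ord_max k0.
  rewrite cofactor_max_second_diff_mx /residue_ramp eqxx nk => <-.
  rewrite det_second_diff_mx // nk nr.
  have -> : q.+1%:R ^+ (k - r) = q.+1%:R ^+ (k - r - 1) * q.+1%:R :> R[i].
    by rewrite -exprSr; congr (_ ^+ _); lia.
  by ring.
apply: (mulIf q2).
have := cofactor_second_diff_mx R[i] k n l k0; rewrite nk => ->.
rewrite detA /residue_ramp nr (modn_small hr).
case: eqP => [E|_]; last by rewrite mulr0 mul0r.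
have -> : n%:R - r%:R = k%:R * q%:R :> R[i] by rewrite hn natrD natrM addrK.
have -> : k%:R + l%:R - r%:R = k%:R * (l %/ k).+1%:R :> R[i].
  by rewrite {1}(divn_eq l k) E natrD natrM -natr1; ring.
have kE : k%:R != 0 :> R[i] by rewrite pnatr_eq0 -lt0n.
have -> : k%:R * q%:R + 2 * k%:R = k%:R * q.+2%:R :> R[i] by rewrite -!natr1; ring.
have -> : k%:R * q%:R + k%:R = k%:R * q.+1%:R :> R[i] by rewrite -!natr1; ring.
rewrite !exprMn.
(* Each base in the numerator carries a factor [k]; together these cancel the denominator. *)
have -> : k%:R ^+ k = k%:R ^+ r * k%:R ^+ (k - r - 1) * k%:R :> R[i].
  by rewrite -exprD -exprSr; congr (_ ^+ _); lia.
by field; rewrite kE !expf_neq0.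
Qed.
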